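(* Let $\mathcal{P}$ be a finite set of primes. Then there exists a group $G$ which is not right orderable and which is a residually finite $p$-group for all $p \in \mathcal{P}$.
   Context: A group $G$ is right orderable if it has a total ordering $\le$ such that $x \le y$ implies $xg \le yg$ for all $g, x, y \in G$. For a prime $p$, a group $G$ is a residually finite $p$-group if for every nonidentity element $g \in G$ there is a normal subgroup $N$ of $G$ with $g \notin N$ such that $G/N$ is a finite $p$-group (i.e. $N$ has finite index equal to a power of $p$). *)

(* Defs.v *)
From mathcomp Require Import all_boot.
From mathcomp Require Import all_classical.

Set Implicit Arguments.
Unset Strict Implicit.
Unset Printing Implicit Defensive.

Local Open Scope card_scope.
Local Open Scope classical_set_scope.
Local Open Scope group_scope.

(* MathComp predicates and relations are boolean; under the classical axioms
   of boolp they are the same as Prop-valued ones, so quantifying over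
   [rel G] and [groupClosed G] covers all relations and all subgroups of an
   arbitrary, possibly infinite, group. *)

Definition right_orderable (G : groupType) : Prop :=
  exists le : rel G,
    [/\ reflexive le, antisymmetric le, transitive le, total le
      & forall g x y : G, le x y -> le (x * g) (y * g)].

(* Here [x ^ g] is the conjugate g^-1 * x * g. *)
Definition normal_subgroup (G : groupType) (N : groupClosed G) : Prop :=
  forall x g : G, x \in N -> x ^ g \in N.

Definition coset_space (G : groupType) (N : groupClosed G) : set (set G) :=
  [set C | exists g : G, C = [set x | x / g \in N]].

(* For N normal, this says that G / N is a finite p-group when p is prime. *)
Definition p_power_index (p : nat) (G : groupType) (N : groupClosed G) : Prop :=
  exists k : nat, coset_space N #= `I_(p ^ k)%N.

Definition residually_finite_p (p : nat) (G : groupType) : Prop :=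
  forall g : G, g <> 1 ->
    exists N : groupClosed G,
      [/\ normal_subgroup N, g \notin N & p_power_index p N].

(* Main.v *)
(* Let N >= 1 be a multiple of every prime in P and G the kernel of
   GL_3(Z) -> GL_3(Z/N).  If p divides N, then A = 1 mod p for every A in G, so
   A^(p^e) = 1 mod p^(e+1); hence the image of G in GL_3(Z/p^(e+1)) is a
   finite p-group, and these images separate the elements of G.

   That G is not right orderable is Witte's argument.  In a right order, let
   z << x mean that |z|^n < |x| for all n.  If z <> 1 commutes with x and y and
   xy = yxz^k with k >= 1, then z << x or z << y: otherwise x, y <= z^n for some
   n (taking x, y, z >= 1), and x^m y^m = y^m x^m z^(k m^2) gives
   z^(k m^2) <= z^(2nm) for all m.  The six matrices 1 + N e_ij can be
   arranged in a cycle a_0, ..., a_5 in which every a_(i+1) is in this way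
   related to its two neighbours, so that << would propagate around the cycle in
   one of the two directions and yield a_0 << a_0. *)
Require Import Defs.
From HB Require Import structures.
From mathcomp Require Import all_boot all_algebra all_fingroup all_solvable.
From mathcomp Require Import all_classical.

Set Implicit Arguments.
Unset Strict Implicit.
Unset Printing Implicit Defensive.

Import GRing.Theory.
Local Open Scope group_scope.

(** * Heisenberg relations and commutators of powers *)

Section HeisenbergRelation.
Variable G : groupType.
Implicit Types x y z : G.

(* The disjunction makes the relation invariant under inverting x, y or z. *)
Definition heisenberg_rel (k : nat) z x y : Prop :=
  [/\ commute z x, commute z y
    & x * y = y * x * z ^+ k \/ y * x = x * y * z ^+ k].

Lemma heisenberg_relC k z x y : heisenberg_rel k z x y -> heisenberg_rel k z y x.
Proof. by case=> zx zy xy; split=> //; case: xy; [right|left]. Qed.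

Lemma heisenberg_relVl k z x y : heisenberg_rel k z x y -> heisenberg_rel k z x^-1 y.
Proof.
case=> zx zy xy; split=> //; first exact: commuteV.
have zxk : z ^+ k * x = x * z ^+ k by apply/commute_sym/commuteX/commute_sym.
by case: xy => xy; [right|left]; apply: (mulgI x); apply: (mulIg x);
  rewrite !mulgA mulgV mul1g ?mulgVK -?[_ * z ^+ k * x]mulgA zxk mulgA ?mulgVK.
Qed.

Lemma heisenberg_relVz k z x y : heisenberg_rel k z x y -> heisenberg_rel k z^-1 x y.
Proof.
case=> zx zy xy; split; try by apply/commute_sym/commuteV/commute_sym.
by case: xy => ->; [right|left]; rewrite expVgn mulgK.
Qed.

Lemma commutator_expl z x y m :
  commute z x -> x * y = y * x * z -> x ^+ m * y = y * x ^+ m * z ^+ m.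
Proof.
move=> zx xy; elim: m => [|m IHm]; first by rewrite !expg0 mul1g !mulg1.
have zmx : commute z (x ^+ m) by exact: commuteX.
by rewrite expgS -mulgA IHm !mulgA xy -!mulgA (mulgA z) zmx !mulgA -mulgA -expgS.
Qed.

(** Commutators with a central value are multiplicative in each argument, so [commutator_expl] is
    applied once to raise [x] to a power and once to raise [y]. *)
Lemma commutator_exp k z x y m :
    commute z x -> commute z y -> x * y = y * x * z ^+ k ->
  x ^+ m * y ^+ m = y ^+ m * x ^+ m * z ^+ (k * m * m).
Proof.
move=> zx zy xy.
have zk j t : commute z t -> commute (z ^+ j) t.
  by move=> zt; apply/commute_sym/commuteX/commute_sym.
have xmy : x ^+ m * y = y * x ^+ m * z ^+ (k * m).
  by rewrite expgnA; apply: commutator_expl => //; apply: zk.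
(* Exchanging the roles of [y] and [x ^+ m] inverts the commutator, hence [z^-1]. *)
have yx : y * x ^+ m = x ^+ m * y * z^-1 ^+ (k * m) by rewrite xmy expVgn mulgK.
have zV t : commute z t -> commute (z^-1 ^+ (k * m)) t.
  by move=> zt; rewrite expVgn; apply/commute_sym/commuteV/commute_sym/zk.
by rewrite (commutator_expl m (zV _ zy) yx) expVgn expVgn -expgnA mulgVK.
Qed.

End HeisenbergRelation.

(** * Domination between elements of a right-ordered group *)

Section RightOrder.
Variables (G : groupType) (le : rel G).
Hypotheses (le_anti : antisymmetric le) (le_trans : transitive le).
Hypotheses (le_total : total le).
Hypothesis le_mulr : forall g x y : G, le x y -> le (x * g) (y * g).
Implicit Types x y z : G.

Lemma le_refl x : le x x.
Proof. by have := le_total x x; rewrite orbb. Qed.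

Definition oabs x := if le 1 x then x else x^-1.

Lemma oabs_ge1 x : le 1 (oabs x).
Proof.
rewrite /oabs; case: ifPn => // n1x.
have /orP[//|x1] := le_total 1 x; first by rewrite (negPf n1x).
by have := le_mulr x^-1 x1; rewrite mulgV mul1g.
Qed.

Lemma oabs_neq1 x : x <> 1 -> oabs x <> 1.
Proof. by rewrite /oabs; case: ifP => // _ x1 /eqP; rewrite invg_eq1 => /eqP. Qed.

(* The relation z << x. *)
Definition dominated z x : Prop := forall n, ~~ le (oabs x) (oabs z ^+ n).

Lemma dominated_irr x : ~ dominated x x.
Proof. by move/(_ 1%N); rewrite expg1 le_refl. Qed.

Lemma dominated_trans y x z : dominated x y -> dominated y z -> dominated x z.
Proof.
move=> xy yz n; apply: contra (yz 1%N) => zx; rewrite expg1.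
by have := le_total (oabs y) (oabs x ^+ n); rewrite (negPf (xy n)); apply: le_trans.
Qed.

Lemma expg_ge1 x n : le 1 x -> le 1 (x ^+ n).
Proof.
move=> x1; elim: n => [|n IHn]; first by rewrite expg0 le_refl.
by apply: le_trans IHn _; have := le_mulr (x ^+ n) x1; rewrite mul1g -expgS.
Qed.

(** Only right multiplication preserves the order, so the induction needs [z] to commute with [x]: x
    x^m <= z^p x^m = x^m z^p <= z^(pm) z^p. *)
Lemma expg_le_bound z x p m : commute z x -> le x (z ^+ p) -> le (x ^+ m) (z ^+ (p * m)).
Proof.
move=> zx xz; elim: m => [|m IHm]; first by rewrite muln0 !expg0 le_refl.
have zxm : commute (z ^+ p) (x ^+ m).
  by apply/commute_sym/commuteX/commute_sym/commuteX.
rewrite expgS; apply: le_trans (le_mulr (x ^+ m) xz) _.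
rewrite zxm mulnS addnC expgnDr; exact: le_mulr.
Qed.

Lemma heisenberg_unbounded k z x y p q :
    (0 < k)%N -> z <> 1 -> heisenberg_rel k z x y ->
    le 1 x -> le 1 y -> le 1 z -> le x (z ^+ p) -> le y (z ^+ q) -> False.
Proof.
move=> k0 z1; wlog xy : x y p q / x * y = y * x * z ^+ k.
  move=> IH H; case: (H) => _ _ [] xy ? ? ? ? ?; first exact: (IH x y p q).
  exact: (IH y x q p) (heisenberg_relC H) _ _ _ _ _.
(* With m = p + q + 1 the quadratic exponent k m^2 already exceeds the linear one (p + q) m. *)
case=> zx zy _ x1 y1 z_ge1 xz yz; pose m := (p + q).+1.
have := commutator_exp m zx zy xy => xym.
have le1 : le (x ^+ m * y ^+ m) (z ^+ (p * m + q * m)).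
  apply: le_trans (le_mulr _ (expg_le_bound m zx xz)) _.
  have -> : z ^+ (p * m) * y ^+ m = y ^+ m * z ^+ (p * m).
    by apply/commute_sym/commuteX/commute_sym/commuteX.
  by rewrite addnC expgnDr; apply/le_mulr/expg_le_bound.
(* The factor y^m x^m to the left of z^(k m^2) is at least x^m, hence at least 1. *)
have le2 : le (z ^+ (k * m * m)) (x ^+ m * y ^+ m).
  rewrite xym -[X in le X _]mul1g; apply: le_mulr.
  apply: le_trans (expg_ge1 m x1) _.
  by have := le_mulr (x ^+ m) (expg_ge1 m y1); rewrite mul1g.
have := le_trans le2 le1; rewrite -mulnDl.
have lt : ((p + q) * m < k * m * m)%N.
  by rewrite ltn_mul2r /= /m; case: (k) k0 => // k' _; rewrite mulSn ltn_addr.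
(* Cancelling z^((p + q) m) on the right leaves a positive power of [z] below 1, while [z] is below
   that power; antisymmetry then forces z = 1. *)
rewrite -(subnK lt) addnS -addSn expgnDr => /(le_mulr (z ^- ((p + q) * m))).
rewrite mulgK mulgV => zle; apply: z1; apply: le_anti; rewrite z_ge1 andbT.
apply: le_trans zle; rewrite expgS.
set j := (_ - _)%N.
by have := le_mulr z (expg_ge1 j z_ge1); rewrite mul1g -expgSr expgS.
Qed.

Lemma heisenberg_dominated k z x y :
    (0 < k)%N -> z <> 1 -> heisenberg_rel k z x y -> dominated z x \/ dominated z y.
Proof.
move=> k0 z1 H; apply: contrapT => /not_orP[].
move=> /existsNP[p /negP/negPn xz] /existsNP[q /negP/negPn yz].
have Hx z' x' y' : heisenberg_rel k z' x' y' -> heisenberg_rel k z' (oabs x') y'.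
  by rewrite /oabs; case: ifP => // _; apply: heisenberg_relVl.
(* Each [oabs] either keeps its argument or inverts it, and the relation survives both. *)
have {}H : heisenberg_rel k (oabs z) (oabs x) (oabs y).
  apply/Hx/heisenberg_relC/Hx/heisenberg_relC.
  by rewrite /oabs; case: ifP => // _; apply: heisenberg_relVz.
by apply: (heisenberg_unbounded k0 (oabs_neq1 z1) H) xz yz; apply: oabs_ge1.
Qed.

End RightOrder.

Lemma cyclic_heisenberg_not_right_orderable (G : groupType) (k n : nat) (a : nat -> G) :
    (0 < k)%N -> (0 < n)%N -> (forall i, a (i + n)%N = a i) -> (forall i, a i <> 1) ->
    (forall i, heisenberg_rel k (a i.+1) (a i) (a i.+2)) ->
  ~ right_orderable G.
Proof.
move=> k0 n0 an a1 Ha [le [_ le_anti le_trans le_total le_mulr]].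
have tr := dominated_trans le_trans le_total.
have irr := dominated_irr le_total.
have step i := heisenberg_dominated le_anti le_trans le_total le_mulr k0 (a1 i.+1) (Ha i).
(* One upward step [a i] << [a i.+1] excludes the downward alternative at [i.+1], so every later
   step goes up; with no upward step at all, every step goes down. *)
have [[i up]|noup] := pselect (exists i, dominated le (a i) (a i.+1)).
  have ups j : dominated le (a (i + j)%N) (a (i + j).+1).
    elim: j => [|j IHj]; first by rewrite addn0.
    rewrite addnS; have [down|//] := step (i + j)%N.
    by case: (irr _ (tr _ _ _ IHj down)).
  have long j : dominated le (a i) (a (i + j.+1)%N).
    elim: j => [|j IHj]; first by rewrite addn1.
    by rewrite addnS; apply: tr IHj (ups _).
  (* [long j] spans [j.+1] steps, so [n.-1] is one full period. *)
  by apply: (irr (a i)); have := long n.-1; rewrite prednK // an.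
have long j : dominated le (a j.+1) (a 0%N).
  have downs i : dominated le (a i.+1) (a i).
    by have [//|up] := step i; case: noup; exists i.+1.
  by elim: j => [|j IHj]; [apply: downs|apply: tr (downs _) IHj].
by apply: (irr (a 0%N)); have := long n.-1; rewrite prednK // -{1}[n]add0n an.
Qed.

(** * Kernels of homomorphisms and their index when the target is finite *)

Definition gkernel (G H : groupType) (f : G -> H) : {pred G} := [pred x | f x == 1].

Section Kernel.
Variables (G H : groupType) (f : UMagmaMorphism.type G H).

Lemma gkernel_closed : group_closed (gkernel f).
Proof.
split=> [|x y]; first by rewrite inE gmulf1.
by rewrite !inE gmulfM gmulfV => /eqP-> /eqP->; rewrite divg1.
Qed.

HB.instance Definition _ :=
  isMulClosed.Build G (gkernel f) (group_closedM gkernel_closed).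
HB.instance Definition _ := isMul1Closed.Build G (gkernel f) gkernel_closed.1.
HB.instance Definition _ :=
  isInvClosed.Build G (gkernel f) (group_closedV gkernel_closed).

Lemma gkernel_normal : normal_subgroup (gkernel f : groupClosed G).
Proof. by move=> x g; rewrite !inE gmulfJ => /eqP->; rewrite conj1g. Qed.

Lemma gkernel_div x y : (x * y^-1 \in gkernel f) = (f x == f y).
Proof. by rewrite inE gmulfM gmulfV; apply: divg_eq1. Qed.

End Kernel.

Section FiniteImage.
Variables (G : groupType) (gT : finGroupType) (f : UMagmaMorphism.type G gT).

(** The source may be infinite, so membership in the image is made boolean by [asbool]. *)
Definition gimage : {set gT} := [set u | `[< exists x, f x = u >]].

Lemma gimageP u : reflect (exists x, f x = u) (u \in gimage).
Proof. by rewrite inE; apply: asboolP. Qed.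

Lemma gimage_group_set : group_set gimage.
Proof.
apply/group_setP; split=> [|_ _ /gimageP[x <-] /gimageP[y <-]]; apply/gimageP.
  by exists 1; rewrite gmulf1.
by exists (x * y); rewrite gmulfM.
Qed.
Canonical gimage_group := Group gimage_group_set.

(** The cosets of the kernel are the fibers of [f] over its image. These fibers are nonempty, so
    each determines its base point. *)
Lemma card_coset_space_gkernel :
  (coset_space (gkernel f : groupClosed G) #= `I_#|gimage|)%card.
Proof.
pose fiber (u : gT) : set G := (fun x => f x = u).
have -> : coset_space (gkernel f : groupClosed G)
    = ((fiber \o enum_val) @` [set: 'I_#|gimage|])%classic.
  have fiberE g : (fun x => x * g^-1 \in gkernel f) = fiber (f g) :> set G.
    by apply/funext => x; rewrite gkernel_div; apply/propext; split=> /eqP.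
  apply/seteqP; split=> [C [g ->]|C [i _ <-]] /=.
    have fg : f g \in gimage by apply/gimageP; exists g.
    by exists (enum_rank_in fg (f g)); rewrite // /comp enum_rankK_in // -fiberE.
  by have /gimageP[g fg] := enum_valP i; exists g; rewrite -fg -fiberE.
rewrite (card_eql (inj_card_eq _)); first by rewrite card_eq_sym card_II.
move=> i j _ _ /= ij; apply: enum_val_inj.
have /gimageP[x fx] := enum_valP i.
suff: fiber (enum_val j) x by rewrite -fx => ->.
by rewrite -ij; exact: fx.
Qed.

(** The exponent of the image divides [p ^ e], and a finite group whose exponent is a power of [p]
    is a [p]-group. *)
Lemma p_power_index_gkernel p e : prime p -> (forall x, f x ^+ (p ^ e) = 1) ->
  p_power_index p (gkernel f : groupClosed G).
Proof.
move=> p_pr fe; have : p.-group gimage.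
  rewrite -pnat_exponent; apply: (@pnat_dvd _ (p ^ e)).
    by apply/exponentP => _ /gimageP[x <-].
  by rewrite pnatX pnat_id.
case/p_natP => k kE; exists k; rewrite -kE; exact: card_coset_space_gkernel.
Qed.

End FiniteImage.

(** * Integer matrices congruent to 1, and the group they form *)

Section CongruenceSubgroup.
Local Open Scope ring_scope.
Variable n : nat.
Implicit Types (N : int) (A B : 'M[int]_n.+1).

Definition congruent1 N A := A - 1 \is a mxOver (dvdz N).

Lemma mxOver_dvdzM d e A B :
  A \is a mxOver (dvdz d) -> B \is a mxOver (dvdz e) -> A * B \is a mxOver (dvdz (d * e)).
Proof.
move=> /mxOverP Ad /mxOverP Be; apply/mxOverP => i j.
by rewrite mxE rpred_sum // => k _; apply: dvdz_mul.
Qed.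

Lemma mxOver_dvdzMr d A B : A \is a mxOver (dvdz d) -> A * B \is a mxOver (dvdz d).
Proof.
move=> Ad; rewrite -[d]mulr1; apply: mxOver_dvdzM => //.
by apply/mxOverP => i j; apply: dvd1z.
Qed.

Lemma congruent1_1 N : congruent1 N 1.
Proof. by rewrite /congruent1 subrr rpred0. Qed.

Lemma congruent1M N A B : congruent1 N A -> congruent1 N B -> congruent1 N (A * B).
Proof.
move=> A1 B1; rewrite /congruent1.
have -> : A * B - 1 = (A - 1) * B + (B - 1) by rewrite mulrBl mul1r addrA subrK.
by rewrite rpredD // mxOver_dvdzMr.
Qed.

Lemma congruent1V N A : A \is a GRing.unit -> congruent1 N A -> congruent1 N A^-1.
Proof.
move=> Au A1; rewrite /congruent1.
have -> : A^-1 - 1 = - ((A - 1) * A^-1) by rewrite mulrBl mul1r divrr // opprB.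
by rewrite rpredN mxOver_dvdzMr.
Qed.

Lemma congruent1X N A m : congruent1 N A -> congruent1 N (A ^+ m).
Proof.
move=> A1; elim: m => [|m IHm]; first exact: congruent1_1.
by rewrite exprS congruent1M.
Qed.

(** Factor A^p - 1 as A - 1 times the sum of the A^i for i < p. Each A^i is 1 modulo [p], so this
    sum of [p] terms vanishes modulo [p]. *)
Lemma congruent1_expp N (p : nat) A :
  (p%:Z %| N)%Z -> congruent1 N A -> congruent1 (N * p%:Z) (A ^+ p).
Proof.
move=> pN A1; rewrite /congruent1 subrX1; apply: mxOver_dvdzM => //.
have -> : \sum_(i < p) A ^+ i = \sum_(i < p) (A ^+ i - 1) + p%:R.
  by rewrite sumrB sumr_const card_ord subrK.
rewrite rpredD // ?rpred_sum // => [i _|].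
  have := congruent1X i A1; apply: mxOverS => x; exact: dvdz_trans.
by apply/mxOverP => i j; rewrite -scaler_nat !mxE natz; apply: dvdz_mulr.
Qed.

Lemma congruent1_exppX (p : nat) A e :
  congruent1 p%:Z A -> congruent1 (p ^ e.+1)%:Z (A ^+ (p ^ e)).
Proof.
move=> A1; elim: e => [|e IHe]; first by rewrite expn1 expn0 expr1.
rewrite expnSr PoszM [X in A ^+ X]expnSr exprM; apply: congruent1_expp IHe.
by rewrite expnS PoszM dvdz_mulr.
Qed.

Lemma congruent1S d N A : (d %| N)%Z -> congruent1 N A -> congruent1 d A.
Proof. by move=> dN; apply: mxOverS => x; apply: dvdz_trans. Qed.

End CongruenceSubgroup.

(** Kernel of GL_(n+1)(Z) -> GL_(n+1)(Z/N); 3 by 3 matrices are the case [n = 2]. *)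
Definition congruence_subgroup (n : nat) (N : int) :=
  {A : 'M[int]_n.+1 | (A \is a GRing.unit) && congruent1 N A}.

Section CongruenceSubgroupType.
Local Open Scope ring_scope.
Variables (n : nat) (N : int).
Local Notation Gamma := (congruence_subgroup n N).
Implicit Types x y : Gamma.

HB.instance Definition _ := SubChoice.on Gamma.

Fact gamma1_proof :
  (1 : 'M[int]_n.+1) \is a GRing.unit /\ congruent1 N (1 : 'M[int]_n.+1).
Proof. by split; [apply: unitr1|apply: congruent1_1]. Qed.

Definition gamma1 : Gamma := exist _ 1 (introT andP gamma1_proof).

Fact gammaM_proof x y : val x * val y \is a GRing.unit /\ congruent1 N (val x * val y).
Proof.
have [/andP[xu x1] /andP[yu y1]] := (valP x, valP y).
by split; [rewrite unitrMl|apply: congruent1M].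
Qed.

Definition gammaM x y : Gamma := exist _ (val x * val y) (introT andP (gammaM_proof x y)).

Fact gammaV_proof x : (val x)^-1 \is a GRing.unit /\ congruent1 N (val x)^-1.
Proof.
have /andP[xu x1] := valP x.
by split; [rewrite unitrV|apply: congruent1V].
Qed.

Definition gammaV x : Gamma := exist _ (val x)^-1 (introT andP (gammaV_proof x)).

Lemma gammaA : associative gammaM.
Proof. by move=> x y z; apply/val_inj/mulrA. Qed.

Lemma gamma1M : left_id gamma1 gammaM.
Proof. by move=> x; apply/val_inj/mul1r. Qed.

Lemma gammaM1 : right_id gamma1 gammaM.
Proof. by move=> x; apply/val_inj/mulr1. Qed.

Lemma gammaVM : left_inverse gamma1 gammaV gammaM.
Proof. by move=> x; have /andP[xu _] := valP x; apply/val_inj/mulVr. Qed.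

Lemma gammaMV : right_inverse gamma1 gammaV gammaM.
Proof. by move=> x; have /andP[xu _] := valP x; apply/val_inj/mulrV. Qed.

HB.instance Definition _ := isGroup.Build Gamma gammaA gamma1M gammaM1 gammaVM gammaMV.

Lemma val_gammaM x y : val (x * y)%g = val x * val y.
Proof. by []. Qed.

Lemma commute_gamma x y : GRing.comm (val x) (val y) -> commute x y.
Proof. by move=> xy; apply: val_inj. Qed.

Lemma val_gammaX x m : val (x ^+ m)%g = val x ^+ m.
Proof. by elim: m => // m IHm; rewrite expgS exprS val_gammaM IHm. Qed.

End CongruenceSubgroupType.

(** * Reduction modulo [m] and residual finiteness *)

Section Reduction.
Local Open Scope ring_scope.
Variables (n : nat) (N : int) (m : nat).
Hypothesis m_gt1 : (1 < m)%N.
Local Notation Gamma := (congruence_subgroup n N).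
Implicit Type x : Gamma.

Definition reduction_mx (A : 'M[int]_n.+1) : 'M['Z_m]_n.+1 := map_mx intr A.

Fact reduction_proof x : reduction_mx (val x) \is a GRing.unit.
Proof. by have /andP[xu _] := valP x; apply: rmorph_unit. Qed.

Definition reduction x : {unit 'M['Z_m]_n.+1} := FinRing.Unit (reduction_proof x).

Fact reduction_morphism :
  (reduction 1%g = 1%g) * {morph reduction : x y / (x * y)%g}.
Proof.
split=> [|x y]; apply: val_inj => /=; first exact: rmorph1.
exact: rmorphM.
Qed.
HB.instance Definition _ := isUMagmaMorphism.Build _ _ reduction reduction_morphism.

(** This depends on [m_gt1]: for [m] at most 1, ['Z_m] is Z/2. *)
Lemma intr_Zp_eq0 (z : int) : (z%:~R == 0 :> 'Z_m) = (m%:Z %| z)%Z.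
Proof.
have natE k : (k%:R == 0 :> 'Z_m) = (m %| k)%N.
  by rewrite -val_eqE /= val_Zp_nat.
by rewrite dvdzE -natE; case: z => k; rewrite ?NegzE //= ?mulrNz ?oppr_eq0.
Qed.

Lemma reduction_eq1 x : (reduction x == 1%g) = congruent1 m%:Z (val x).
Proof.
rewrite -val_eqE /= -subr_eq0 -[1 in LHS](rmorph1 (map_mx intr)) -map_mxB.
apply/eqP/mxOverP => [/matrixP A0 i j|A0].
  by have := A0 i j; rewrite !mxE => /eqP; rewrite intr_Zp_eq0.
by apply/matrixP => i j; have := A0 i j; rewrite !mxE -intr_Zp_eq0 => /eqP.
Qed.

End Reduction.

Lemma congruence_subgroup_residually_p (n : nat) (N : int) (p : nat) :
  prime p -> (p%:Z %| N)%Z -> residually_finite_p p (congruence_subgroup n N).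
Proof.
move=> p_pr pN g g1.
have [e ge] : exists e, ~~ congruent1 (p ^ e.+1)%:Z (val g).
  have : (val g - 1 != 0)%R.
    by rewrite subr_eq0; apply/eqP => gE; apply: g1; apply: val_inj.
  (* For e the absolute value of a nonzero entry, p^(e+1) > e cannot divide that entry. *)
  case/matrix0Pn => i [j nz]; exists `|(val g - 1)%R i j|%N.
  apply/mxOverP => /(_ i j); rewrite dvdzE /= => /dvdn_leq.
  rewrite absz_gt0 nz => /(_ isT); apply/negP; rewrite -ltnNge.
  exact: ltn_trans (ltnSn _) (ltn_expl _ (prime_gt1 p_pr)).
have m_gt1 : (1 < p ^ e.+1)%N by rewrite -(exp1n e.+1) ltn_exp2r // prime_gt1.
exists (gkernel (@reduction n N (p ^ e.+1)) : groupClosed _); split.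
- exact: gkernel_normal.
- by rewrite inE reduction_eq1.
apply: (@p_power_index_gkernel _ _ _ p e) => // x; apply/eqP.
rewrite -gmulfXn reduction_eq1 // val_gammaX; apply: congruent1_exppX.
by have /andP[_] := valP x; apply: congruent1S.
Qed.

(** * Elementary matrices and their commutators *)

Section ElementaryMatrices.
Local Open Scope ring_scope.
Variables (n N : nat).
Local Notation Gamma := (congruence_subgroup n N).
Implicit Types (i j k : 'I_n.+1) (a b : int).

Definition elementary_mx i j a : 'M[int]_n.+1 := 1 + a *: delta_mx i j.

Lemma elementary_mxM i j k l a b : j != k ->
  elementary_mx i j a * elementary_mx k l b =
  1 + a *: delta_mx i j + b *: delta_mx k l.
Proof.
move=> jk; rewrite /elementary_mx mulrDl mul1r mulrDr mulr1 -scalerAl -scalerAr.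
rewrite [delta_mx i j * _]mul_delta_mx_0 // !scaler0 addr0.
by rewrite addrAC.
Qed.

Lemma elementary_mx_comm i j k l a b : j != k -> l != i ->
  GRing.comm (elementary_mx i j a) (elementary_mx k l b).
Proof. by move=> jk li; rewrite /GRing.comm !elementary_mxM // addrAC. Qed.

Lemma elementary_mxD i j a b : i != j ->
  elementary_mx i j a * elementary_mx i j b = elementary_mx i j (a + b).
Proof. by move=> ij; rewrite elementary_mxM 1?eq_sym // -addrA -scalerDl. Qed.

Lemma elementary_mxX i j a m : i != j ->
  elementary_mx i j a ^+ m = elementary_mx i j (a *+ m).
Proof.
move=> ij; elim: m => [|m IHm]; first by rewrite /elementary_mx mulr0n scale0r addr0.
by rewrite exprS IHm elementary_mxD // mulrS.
Qed.

(** The left product contains the mixed term a b e_ik. In the reversed product it is absent, since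
    e_jk e_ij = 0, and the last factor restores it. *)
Lemma elementary_mx_commutator i j k a b : i != j -> j != k -> i != k ->
  elementary_mx i j a * elementary_mx j k b =
  elementary_mx j k b * elementary_mx i j a * elementary_mx i k (a * b).
Proof.
move=> ij jk ik; rewrite [elementary_mx j k b * _]elementary_mxM 1?eq_sym //.
rewrite /elementary_mx !mulrDl !mulrDr !mul1r !mulr1 -!scalerAl -!scalerAr.
rewrite [delta_mx i j * delta_mx j k]mul_delta_mx.
have del0 p q : q != i -> delta_mx p q * delta_mx i k = 0 :> 'M[int]_n.+1.
  exact: mul_delta_mx_0.
rewrite !del0 1?eq_sym // !scaler0 !addr0 scalerA.
by rewrite -!addrA [X in _ = _ + X]addrC -addrA.
Qed.

Fact elementary_proof i j : i != j ->
  (elementary_mx i j N%:Z \is a GRing.unit) && congruent1 N%:Z (elementary_mx i j N%:Z).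
Proof.
move=> ij; apply/andP; split.
  apply/unitrP; exists (elementary_mx i j (- N%:Z)).
  by rewrite !elementary_mxD // addNr subrr /elementary_mx scale0r addr0.
rewrite /congruent1 /elementary_mx addrC addKr.
by apply/mxOverP => p q; rewrite mxE; apply: dvdz_mulr.
Qed.

(* [insubd] gives the junk value 1 when [i = j]. *)
Definition elementary i j : Gamma := insubd (1%g : Gamma) (elementary_mx i j N%:Z).

Lemma val_elementary i j : i != j -> val (elementary i j) = elementary_mx i j N%:Z.
Proof. by move=> ij; rewrite insubdK // unfold_in; apply: elementary_proof. Qed.

Lemma elementary_neq1 i j : (0 < N)%N -> i != j -> elementary i j <> 1%g.
Proof.
move=> N0 ij /(congr1 val); rewrite val_elementary // /elementary_mx.
move/(canRL (addKr _)); rewrite [X in - 1 + X](_ : _ = 1) // addNr.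
move/matrixP/(_ i j); rewrite !mxE !eqxx mulr1 => /eqP.
by rewrite -[_ == _]/(N == 0)%N; case: N N0.
Qed.

(** The commutator is 1 + N^2 e_ik, the [N]-th power of 1 + N e_ik; this is why the exponent is
    [N]. *)
Lemma elementary_heisenberg i j k : i != j -> j != k -> i != k ->
  heisenberg_rel N (elementary i k) (elementary i j) (elementary j k).
Proof.
move=> ij jk ik; have [ji kj ki] : [/\ j != i, k != j & k != i] by split; rewrite eq_sym.
move: (elementary i j) (elementary j k) (elementary i k)
  (val_elementary ij) (val_elementary jk) (val_elementary ik) => x y z xE yE zE.
split.
- by apply: commute_gamma; rewrite zE xE; apply: elementary_mx_comm.
- by apply: commute_gamma; rewrite zE yE; apply: elementary_mx_comm.
left; apply: val_inj; rewrite !val_gammaM val_gammaX xE yE zE.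
by rewrite elementary_mxX // -mulr_natr natz; apply: elementary_mx_commutator.
Qed.

End ElementaryMatrices.

(* The pairs ([root_row t], [root_col t]) run cyclically through the six off-diagonal
   positions (0,1), (0,2), (1,2), (1,0), (2,0), (2,1). *)
Definition root_row (t : nat) : 'I_3 := (t./2)%:R%R.
Definition root_col (t : nat) : 'I_3 := (root_row t.+1 + 1)%R.

Lemma root_rowD6 t : root_row (t + 6) = root_row t.
Proof.
rewrite /root_row halfD andbF add0n natrD [X in (_ + X)%R](_ : _ = 0%R) ?addr0 //.
exact: val_inj.
Qed.

Lemma root_rowSS t : root_row t.+2 = (root_row t + 1)%R.
Proof. by rewrite /root_row /= -natr1. Qed.

Lemma root_rowS t : root_row t.+1 = (root_row t + (odd t)%:R)%R.
Proof. by rewrite /root_row -natrD -uphalfE uphalf_half addnC. Qed.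

Lemma ord3_distinct (s : 'I_3) : [/\ s != s + 1, s + 1 != s + 1 + 1 & s != s + 1 + 1]%R.
Proof. by case: s => [[|[|[|//]]] ?]. Qed.

Lemma ord3_addr3 (s : 'I_3) : (s + 1 + 1 + 1 = s)%R.
Proof. by apply: val_inj; case: s => [[|[|[|//]]] ?]. Qed.

Lemma congruence_subgroup_not_right_orderable (N : nat) :
  (0 < N)%N -> ~ right_orderable (congruence_subgroup 2 N).
Proof.
move=> N0.
apply: (@cyclic_heisenberg_not_right_orderable _ N 6
  (fun t => elementary N (root_row t) (root_col t)) N0 isT).
- by move=> t; rewrite /root_col -addSn !root_rowD6.
- move=> t; apply: (elementary_neq1 N0); rewrite /root_col root_rowS.
  by have [s1 _ s2] := ord3_distinct (root_row t); case: odd; rewrite ?addr0.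
move=> t; rewrite /root_col !root_rowSS root_rowS.
have [s1 s2 s3] := ord3_distinct (root_row t).
(* Put s = [root_row t]. For [t] even the three positions are (s, s+1), (s, s+2), (s+1, s+2). For
   [t] odd they are (s, s+2), (s+1, s+2), (s+1, s), whose outer two occur in the opposite order. *)
case: odd; rewrite ?addr0; last exact: elementary_heisenberg.
rewrite ord3_addr3; apply: heisenberg_relC.
by apply: elementary_heisenberg => //; rewrite eq_sym.
Qed.

Theorem theorem1 (P : set nat) (finP : finite_set P)
    (primeP : forall p : nat, P p -> prime p) :
  exists G : groupType,
    ~ right_orderable G /\ (forall p : nat, P p -> residually_finite_p p G).
Proof.
have [s PE] := (finite_seqP P).1 finP.
have N0 : 0 < \prod_(p <- s) p.
  by rewrite big_seq prodn_cond_gt0 // => p ps; apply/prime_gt0/primeP; rewrite PE.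
(* If [P] is empty, the product is 1 and the group is GL_3(Z). *)
exists (congruence_subgroup 2 (\prod_(p <- s) p)%N).
split=> [|p Pp]; first exact: congruence_subgroup_not_right_orderable.
apply: congruence_subgroup_residually_p (primeP p Pp) _.
by rewrite dvdzE /= (big_rem p) ?dvdn_mulr //; move: Pp; rewrite PE.
Qed.
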